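(* Let $\mathcal{L}$ be a first-order language and $T$ a complete theory in $\mathcal{L}$. Then $T$ is stable if and only if for every formula $\varphi(x_1,\ldots,x_n;y_1,\ldots,y_m)$ of $\mathcal{L}$ and every model $\mathcal{M}$ of $T$, the associated game $G(\mathcal{L},T,\varphi,\mathcal{M})$ is totally minimax.
   Context: A formula $\varphi(x_1,\ldots,x_n;y_1,\ldots,y_m)$ has the order property over $T$ if there is a model $\mathcal{M}$ of $T$ and sequences $(\mathbf{a}_i)_{i\ge1}$ of $n$-tuples and $(\mathbf{b}_j)_{j\ge1}$ of $m$-tuples of elements of $\mathcal{M}$ with $\mathcal{M}\models\varphi(\mathbf{a}_i;\mathbf{b}_j)\iff i\ge j$. $T$ is stable if no formula has the order property over $T$. The game $G(\mathcal{L},T,\varphi,\mathcal{M})$ is the two-person win-lose game $(S,T',\pi)$ with $S=\mathcal{M}^n$, $T'=\mathcal{M}^m$, and $\pi(\mathbf{a},\mathbf{b})=1$ iff $\mathcal{M}\models\varphi(\mathbf{a};\mathbf{b})$. For a win-lose game $(S,T',\pi)$ ($\pi:S\times T'\to\{0,1\}$), $\Delta(X)$ is the set of probability distributions on $X$ with at most countable support, $\pi^{\mathrm{mix}}(\mathbf{p},\mathbf{q})=\sum p_sq_t\pi(s,t)$; the game has the minimax property if $\sup_{\mathbf{p}\in\Delta(S)}\inf_{\mathbf{q}\in\Delta(T')}\pi^{\mathrm{mix}}(\mathbf{p},\mathbf{q})=\inf_{\mathbf{q}\in\Delta(T')}\sup_{\mathbf{p}\in\Delta(S)}\pi^{\mathrm{mix}}(\mathbf{p},\mathbf{q})$;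 it is totally minimax if every subgame $(S_0,T_0,\pi|_{S_0\times T_0})$ with non-empty $S_0\subseteq S$, $T_0\subseteq T'$ has the minimax property. *)

(* Defs.v *)
From HB Require Import structures.
From mathcomp Require Import all_boot all_order all_algebra.
From mathcomp Require Import boolp classical_sets cardinality reals.
From mathcomp Require Import constructive_ereal ereal esum Rstruct.

Set Implicit Arguments.
Unset Strict Implicit.
Unset Printing Implicit Defensive.

Import Order.TTheory GRing.Theory Num.Theory.
Local Open Scope classical_set_scope.
Local Open Scope ring_scope.

(** A first-order language: function symbols and relation symbols with arities
    (constants are 0-ary function symbols). Equality is logical. *)
Record language := Language {
  func_sym : Type;
  rel_sym : Type;
  func_ar : func_sym -> nat;
  rel_ar : rel_sym -> nat }.

Section FOL.
Variable L : language.

Inductive term : Type :=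
| tvar : nat -> term
| tapp : forall f : func_sym L, ('I_(func_ar f) -> term) -> term.

Inductive formula : Type :=
| ffalse : formula
| fequal : term -> term -> formula
| frel : forall r : rel_sym L, ('I_(rel_ar r) -> term) -> formula
| fnot : formula -> formula
| fand : formula -> formula -> formula
| f_or : formula -> formula -> formula
| fimp : formula -> formula -> formula
| fall : nat -> formula -> formula
| fex : nat -> formula -> formula.

Record structure := Structure {
  carrier :> Type;
  point : carrier;
  fun_interp : forall f : func_sym L, ('I_(func_ar f) -> carrier) -> carrier;
  rel_interp : forall r : rel_sym L, ('I_(rel_ar r) -> carrier) -> Prop }.

Fixpoint teval (M : structure) (rho : nat -> M) (t : term) : M :=
  match t with
  | tvar x => rho x
  | tapp f args => @fun_interp M f (fun i => teval rho (args i))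
  end.

Definition update (M : structure) (rho : nat -> M) (x : nat) (d : M) : nat -> M :=
  fun y => if y == x then d else rho y.

Fixpoint sat (M : structure) (rho : nat -> M) (phi : formula) : Prop :=
  match phi with
  | ffalse => False
  | fequal t1 t2 => teval rho t1 = teval rho t2
  | frel r args => @rel_interp M r (fun i => teval rho (args i))
  | fnot p => ~ sat rho p
  | fand p q => sat rho p /\ sat rho q
  | f_or p q => sat rho p \/ sat rho q
  | fimp p q => sat rho p -> sat rho q
  | fall x p => forall d : M, sat (update rho x d) p
  | fex x p => exists d : M, sat (update rho x d) p
  end.

Fixpoint occurs (x : nat) (t : term) : Prop :=
  match t with
  | tvar y => y = x
  | tapp f args => exists i, occurs x (args i)
  end.

Fixpoint free_in (x : nat) (phi : formula) : Prop :=
  match phi with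
  | ffalse => False
  | fequal t1 t2 => occurs x t1 \/ occurs x t2
  | frel r args => exists i, occurs x (args i)
  | fnot p => free_in x p
  | fand p q | f_or p q | fimp p q => free_in x p \/ free_in x q
  | fall y p | fex y p => x <> y /\ free_in x p
  end.

Definition fv_below (k : nat) (phi : formula) : Prop :=
  forall x, free_in x phi -> (x < k)%N.

Definition sentence (phi : formula) : Prop := forall x, ~ free_in x phi.

Definition theory := formula -> Prop.

Definition holds_in (M : structure) (phi : formula) : Prop :=
  forall rho : nat -> M, sat rho phi.

Definition is_model (M : structure) (T : theory) : Prop :=
  forall phi, T phi -> holds_in M phi.

Definition complete_theory (T : theory) : Prop :=
  [/\ (forall phi, T phi -> sentence phi),
      (exists M : structure, is_model M T) &
      (forall phi, sentence phi ->
         (forall M : structure, is_model M T -> holds_in M phi) \/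
         (forall M : structure, is_model M T -> holds_in M (fnot phi)))].

(** Convention for phi(x_1,...,x_n; y_1,...,y_m): x_i is variable i-1 (i.e.
    variable k for k : 'I_n) and y_j is variable n+j-1; phi has all its free
    variables among them (fv_below (n+m) phi).  The assignment sending the
    x's to the n-tuple a and the y's to the m-tuple b: *)
Definition env (M : structure) (n m : nat) (a : 'I_n -> M) (b : 'I_m -> M)
  : nat -> M :=
  fun k => match (insub k : option 'I_n) with
           | Some i => a i
           | None => match (insub (k - n)%N : option 'I_m) with
                     | Some j => b j
                     | None => point M
                     end
           end.

Definition sat2 (M : structure) (n m : nat) (phi : formula)
  (a : 'I_n -> M) (b : 'I_m -> M) : Prop := sat (env a b) phi.

Definition order_property (T : theory) (n m : nat) (phi : formula) : Prop :=
  exists (M : structure) (a : nat -> 'I_n -> M) (b : nat -> 'I_m -> M),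
    is_model M T /\
    forall i j : nat, (1 <= i)%N -> (1 <= j)%N ->
      (sat2 phi (a i) (b j) <-> (j <= i)%N).

Definition stable (T : theory) : Prop :=
  forall (n m : nat) (phi : formula), fv_below (n + m) phi ->
    ~ order_property T n m phi.

End FOL.

Section Games.
Local Notation R := Rdefinitions.R.

Definition distr (X : Type) : set (X -> R) :=
  [set p | (forall x, 0 <= p x) /\ countable [set x | p x != 0] /\
           (\esum_(x in [set: {classic X}]) (p x)%:E = 1)%E].

Arguments distr : clear implicits.

Definition mixed_payoff (X Y : Type) (pi : X -> Y -> bool)
  (p : X -> R) (q : Y -> R) : \bar R :=
  (\esum_(st in [set: {classic (X * Y)}]) (p st.1 * q st.2 * (pi st.1 st.2)%:R)%:E)%E.

Definition minimax_property (X Y : Type) (pi : X -> Y -> bool) : Prop :=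
  ereal_sup [set ereal_inf [set mixed_payoff pi p q | q in distr Y]
            | p in distr X] =
  ereal_inf [set ereal_sup [set mixed_payoff pi p q | p in distr X]
            | q in distr Y].

Definition totally_minimax (X Y : Type) (pi : X -> Y -> bool) : Prop :=
  forall (S0 : set X) (T0 : set Y), S0 !=set0 -> T0 !=set0 ->
    minimax_property
      (fun (s : {x : X | S0 x}) (t : {y : Y | T0 y}) => pi (proj1_sig s) (proj1_sig t)).

End Games.

Definition formula_game (L : language) (n m : nat) (phi : formula L)
  (M : structure L) : ('I_n -> M) -> ('I_m -> M) -> bool :=
  fun a b => `[< sat2 phi a b >].
Arguments formula_game {L} n m phi M.

(* Main.v *)
Require Import Defs.
From HB Require Import structures.
From mathcomp Require Import all_boot all_order all_algebra.
From mathcomp Require Import finmap.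
From mathcomp Require Import boolp classical_sets cardinality reals.
From mathcomp Require Import constructive_ereal ereal esum Rstruct.
From mathcomp Require Import fsbigop filter lra.

(** A half graph [pi(a_i, b_j) = (j <= i)] is not minimax: any countable
    distribution puts most of its mass on finitely many [a_i] (or [b_j]), and is
    beaten by a pure strategy of large index. Conversely, suppose that a subgame
    of a model has a gap [a < b] between its two values. Minimax with one finite
    side provides, alternately, finite mixed strategies [q_j], [p_i] such that
    [pi(p_i, q_j)] is at least [b'] for [j <= i] and at most [a'] for [i < j],
    where [a' < b']. This order property for means descends to pure strategies,
    one side at a time: along a nonprincipal ultrafilter, let [g] be the limit of
    the functions [f(x_i, .)]; the sets where [g - f(x_i, .)] is large have
    frequency bounded below in [q_j], hence infinitely many of them can be chosen
    with nonempty finite intersections (a combinatorial lemma of Ptak), and points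
    of these intersections form a half graph with the [x_i]. The half graph lives
    in the given model, so no compactness theorem is needed. *)

Set Implicit Arguments.
Unset Strict Implicit.
Unset Printing Implicit Defensive.

Import Order.TTheory GRing.Theory Num.Theory.

(** * Means over finite lists, and the descent of order from means to points *)

Section RobustOrder.
Local Open Scope classical_set_scope.
Local Open Scope ring_scope.
Variable R : realType.

(* Since [x / 0 = 0], the mean over the empty list is [0]. *)
Definition mean (Y : Type) (f : Y -> R) (l : seq Y) : R :=
  (\sum_(y <- l) f y) / (size l)%:R.

Lemma meanD (Y : Type) (f g : Y -> R) l :
  mean (fun y => f y + g y) l = mean f l + mean g l.
Proof. by rewrite /mean big_split mulrDl. Qed.

Lemma meanN (Y : Type) (f : Y -> R) l : mean (fun y => - f y) l = - mean f l.
Proof. by rewrite /mean sumrN mulNr. Qed.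

Lemma meanZ (Y : Type) (c : R) (f : Y -> R) l :
  mean (fun y => c * f y) l = c * mean f l.
Proof. by rewrite /mean -mulr_sumr mulrA. Qed.

Lemma exchange_mean (X Y : Type) (f : X -> Y -> R) k l :
  mean (fun x => mean (f x) l) k = mean (fun y => mean (f^~ y) k) l.
Proof.
rewrite /mean -!mulr_suml exchange_big /=.
by rewrite mulrAC.
Qed.

Lemma le_mean_In (Y : Type) (f g : Y -> R) l :
  (forall y, List.In y l -> f y <= g y) -> mean f l <= mean g l.
Proof.
move=> fg; rewrite /mean ler_wpM2r ?invr_ge0//.
elim: l fg => [|y l IH] fg; first by rewrite !big_nil.
rewrite !big_cons lerD//; first by apply: fg; left.
by apply: IH => z zl; apply: fg; right.
Qed.

Lemma le_mean (Y : Type) (f g : Y -> R) l :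
  (forall y, f y <= g y) -> mean f l <= mean g l.
Proof. by move=> fg; apply: le_mean_In. Qed.

Lemma mean_cst (Y : Type) (c : R) (l : seq Y) :
  l <> [::] -> mean (fun=> c) l = c.
Proof.
move=> l0; rewrite /mean big_const_seq count_predT iter_addr_0 -[c *+ _]mulr_natr mulfK//.
by rewrite pnatr_eq0; case: l l0.
Qed.

Lemma mean_cst_le (Y : Type) (c : R) (l : seq Y) :
  0 <= c -> mean (fun=> c) l <= c.
Proof.
case: l => [|y l] c0; first by rewrite /mean big_nil mul0r.
by rewrite mean_cst.
Qed.

Definition freq (Y : Type) (l : seq Y) (A : set Y) : R :=
  mean (fun y => `[< A y >]%:R) l.

Lemma le_freq (Y : Type) (l : seq Y) A B : A `<=` B -> freq l A <= freq l B.
Proof.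
move=> AB; apply: le_mean => y; rewrite ler_nat.
by case: (asboolP (A y)) => // /AB By; rewrite asboolT.
Qed.

Lemma freqUI (Y : Type) (l : seq Y) A B :
  freq l (A `|` B) + freq l (A `&` B) = freq l A + freq l B.
Proof.
rewrite /freq -!meanD; congr mean; apply/funext => y.
rewrite asbool_or asbool_and.
by case: `[< A y >]; case: `[< B y >]; rewrite /= ?addr0 ?add0r.
Qed.

Lemma freq_ge0 (Y : Type) (l : seq Y) A : 0 <= freq l A.
Proof. by rewrite divr_ge0// sumr_ge0. Qed.

Lemma freq_le1 (Y : Type) (l : seq Y) A : freq l A <= 1.
Proof.
apply: (le_trans (@le_mean _ _ (fun=> 1) _ _)); last exact: mean_cst_le.
by move=> y; case: `[< A y >].
Qed.

Lemma freq_set0 (Y : Type) (l : seq Y) : freq l set0 = 0.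
Proof. by rewrite /freq /mean big1 ?mul0r// => y _; rewrite asboolF. Qed.

Lemma freq_gt0_nonempty (Y : Type) (l : seq Y) A : 0 < freq l A -> A !=set0.
Proof.
move=> l0; apply/set0P/eqP => A0.
by move: l0; rewrite A0 freq_set0 ltxx.
Qed.

(** The limit is the supremum of the [r] with [r <= u n] for [U]-many [n]: anything above it fails
    this, so, [U] being ultra, [u n] is [U]-often smaller. *)
Lemma ultra_bounded_cvg (U : set_system nat) {UF : UltraFilter U}
    (u : nat -> R) (M : R) : (forall n, `|u n| <= M) ->
  exists g, forall e, 0 < e -> U [set n | `|u n - g| < e].
Proof.
move=> uM; pose A := [set r | U [set n | r <= u n]].
have ubA : ubound A M.
  move=> r /filter_ex[n /= rn]; apply: (le_trans rn).
  by rewrite (le_trans (ler_norm _)).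
have hA : has_sup A.
  split; last by exists M.
  exists (- M); apply: filterS filterT => n _ /=.
  by have := uM n; rewrite ler_norml => /andP[].
exists (sup A) => e e0.
have [r Ar er] := sup_adherent e0 hA.
have : ~ A (sup A + e / 2).
  move=> /(sup_ubound hA.2); lra.
have [//|Uc _] := in_ultra_setVsetC [set n | sup A + e / 2 <= u n] UF.
apply: filterS2 Ar Uc => n /= rn /negP; rewrite -ltNge => nr.
by rewrite ltr_norml; apply/andP; split; lra.
Qed.

(* If sets of frequency at least [c] had pairwise intersections of frequency
   below [c / 2n], the union of [n] of them would have frequency at least
   [n c / 2 > 1]. *)
Lemma freq_refine (Y : Type) (U : set_system nat) {UF : UltraFilter U}
    (q : nat -> seq Y) (G : nat -> set Y) (c : R) (W : set nat) :
  0 < c -> U W -> U [set i | U [set j | c <= freq (q j) (G i)]] ->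
  exists2 i, W i & exists2 c', 0 < c' &
    U [set i' | U [set j | c' <= freq (q j) (G i `&` G i')]].
Proof.
move=> c0 UW UG; pose n := (Num.truncn (2 / c)).+1.
have n0 : 0 < n%:R :> R by rewrite ltr0n.
have cn : 1 < n%:R * (c / 2).
  have : 2 / c < n%:R by exact: truncnS_gt.
  by rewrite ltr_pdivrMr// => ?; rewrite mulrA; lra.
pose d := c / 2 / n%:R.
have d0 : 0 < d by rewrite !divr_gt0.
have nd : n%:R * d = c / 2 by rewrite /d mulrC divfK// gt_eqF.
apply: contrapT => noi.
have disj i : W i -> U [set i' | U [set j | freq (q j) (G i `&` G i') < d]].
  move=> Wi.
  have [Ud|Ud] := in_ultra_setVsetC
    [set i' | U [set j | d <= freq (q j) (G i `&` G i')]] UF.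
    by exfalso; apply: noi; exists i => //; exists d.
  apply: filterS Ud => i' /= Ui'.
  have [//|] := in_ultra_setVsetC [set j | d <= freq (q j) (G i `&` G i')] UF.
  by apply: filterS => j /= /negP; rewrite -ltNge.
suff [H UH _] : exists2 H, U [set j | n%:R * (c / 2) <= freq (q j) H] &
    U [set i' | U [set j | freq (q j) (H `&` G i') <= n%:R * d]].
  have [j /= Hj] := filter_ex UH.
  by have := freq_le1 (q j) H; lra.
have : (n <= n)%N by [].
elim: {-2}n => [_|k IH kn].
  exists set0; first by apply: filterS filterT => j _ /=; rewrite mul0r freq_ge0.
  apply: filterS filterT => i _ /=; apply: filterS filterT => j _ /=.
  by rewrite set0I freq_set0 mul0r.
have [H UH UHG] := IH (ltnW kn).
have [i /= [[Wi ci] Hi]] := filter_ex (filterI (filterI UW UG) UHG).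
exists (H `|` G i).
  apply: filterS3 UH ci Hi => j /= cH cG HG.
  have := freqUI (q j) H (G i); rewrite -natr1 mulrDl mul1r.
  have : k%:R * d <= c / 2 by rewrite -nd ler_wpM2r ?ler_nat ?ltW// ltnW.
  lra.
apply: filterS2 UHG (disj _ Wi) => i' /= U1 U2.
apply: filterS2 U1 U2 => j /= d1 d2.
have := freqUI (q j) (H `&` G i') (G i `&` G i').
rewrite setIUl -natr1 mulrDl mul1r.
have := freq_ge0 (q j) (H `&` G i' `&` (G i `&` G i')).
lra.
Qed.

(** A real-valued order property with a uniform gap. With the diagonal left free, it is preserved by
    exchanging the two sides and negating [f]. *)
Definition robust_order (X Y : Type) (f : X -> Y -> R) : Prop :=
  exists (a b : R) (x : nat -> X) (y : nat -> Y),
    [/\ a < b, (forall i j, (j < i)%N -> b <= f (x i) (y j)) &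
        (forall i j, (i < j)%N -> f (x i) (y j) <= a)].

Lemma nonprincipal_ultrafilter :
  exists U : set_system nat, UltraFilter U /\
    forall n, U [set i | (n < i)%N].
Proof.
have [U [UF UE]] := ultraFilterLemma eventually_filter.
exists U; split => // n; apply: UE.
by exists n.+1.
Qed.

Lemma increasing_enumeration (U : set_system nat) {UF : UltraFilter U} (W : set nat) :
  (forall n, U [set i | (n < i)%N]) -> U W ->
  exists h : nat -> nat, {homo h : i j / (i < j)%N} /\ forall i, W (h i).
Proof.
move=> Uoo UW.
have /choice[s sP] : forall n, exists m, (n < m)%N /\ W m.
  by move=> n; have [m [nm Wm]] := filter_ex (filterI (Uoo n) UW); exists m.
exists (fun i => iter i.+1 s 0%N); split => [|i]; last by case: (sP (iter i s 0%N)).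
apply: (homo_ltn ltn_trans) => i.
by case: (sP (iter i.+1 s 0%N)).
Qed.

(** Once a point [z] is fixed, later [x i] are taken with [f (x i) z] near [g z], while earlier
    [x i] keep [f (x i) z] at least [e] below [g z] because [z] was chosen in their sets [E i]. *)
Lemma robust_order_mean (X Y : Type) (f : X -> Y -> R) :
  (forall x y, `|f x y| <= 1) ->
  robust_order (fun x => mean (f x)) -> robust_order f.
Proof.
move=> f1 [a [b [x [q [ab hi lo]]]]].
have [U [UF Uoo]] := nonprincipal_ultrafilter.
have /choice[g gP] y := @ultra_bounded_cvg U UF (fun i => f (x i) y) 1 (fun i => f1 _ _).
pose e := (b - a) / 4.
have e0 : 0 < e by rewrite divr_gt0// subr_gt0.
have gM y : g y <= 1 + e.
  have [i /=] := filter_ex (gP y _ e0).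
  by rewrite ltr_norml => /andP[? _]; have := f1 (x i) y; rewrite ler_norml; lra.
(* Since [q j] is finite, a single [i > j] satisfies [f (x i) y - e <= g y] at all its points. *)
have geb j : b - e <= mean g (q j).
  have Ul : U [set i | forall y, List.In y (q j) -> f (x i) y - e <= g y].
    elim: (q j) => [|y l IH]; first by apply: filterS filterT => i _ z.
    apply: filterS2 (gP y _ e0) IH => i /=; rewrite ltr_norml => /andP[_ iy] IH.
    by move=> z [<-|/IH//]; lra.
  have [i /= [ij fg]] := filter_ex (filterI (Uoo j) Ul).
  have := hi _ _ ij; have := le_mean_In fg; rewrite meanD.
  have : mean (fun=> - e) (q j) >= - e.
    by rewrite meanN lerN2; apply: mean_cst_le; exact: ltW.
  lra.
pose E i := [set y | e <= g y - f (x i) y].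
pose good F := exists2 c, 0 < c & U [set i | U [set j | c <= freq (q j) (F `&` E i)]].
have goodT : good setT.
  (* For [i < j], [g - f (x i)] has mean at least [b - e - a = 3 * e] on [q j] and never exceeds
     [2 + e]; points outside [E i] contribute at most [e] to this mean. *)
  exists (e / (2 + e)); first by rewrite divr_gt0//; lra.
  apply: filterS filterT => i _ /=.
  apply: filterS (Uoo i) => j /= ij.
  rewrite setTI ler_pdivrMr; last lra.
  have : mean (fun y => g y - f (x i) y) (q j) <=
         mean (fun y => (2 + e) * `[< E i y >]%:R + e) (q j).
    apply: le_mean => y; have := gM y; have := f1 (x i) y.
    rewrite ler_norml => /andP[? ?] ?.
    case: (asboolP (E i y)) => /= [_|]; first lra.
    by rewrite /E /= => /negP; rewrite -ltNge; lra.
  rewrite !meanD meanN meanZ -/(freq (q j) (E i)).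
  have := mean_cst_le (q j) (ltW e0); have := geb j; have := lo _ _ ij.
  rewrite /e; nra.
(* A state holds the last index and point, a set [F] containing all later points, and a [U]-large
   set of indices containing all later indices. *)
pose step (s s' : nat * Y * set Y * set nat) :=
  [/\ s.2 s'.1.1.1, s'.1.2 `<=` s.1.2 `&` E s'.1.1.1, s'.1.2 s'.1.1.2 &
      s'.2 `<=` s.2 `&` [set i | `|f (x i) s'.1.1.2 - g s'.1.1.2| < e / 2]].
pose ok (s : nat * Y * set Y * set nat) := good s.1.2 /\ U s.2.
have /choice[nx nxP] : forall s, exists s', ok s -> step s s' /\ ok s'.
  move=> [[[i0 y0] F] W]; rewrite /ok /=.
  have [[[c c0 Fc] UW]|] := pselect (good F /\ U W); last by move=> ?; exists (i0, y0, F, W).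
  have [i Wi [c' c'0 Fc']] := freq_refine c0 UW Fc.
  have gF : good (F `&` E i).
    exists c' => //; apply: filterS Fc' => i'; apply: filterS => j /=.
    by move/le_trans; apply; apply: le_freq => y [[? ?] [? ?]].
  have [i' /filter_ex[j /= c'j]] := filter_ex Fc'.
  have [y [Fy _]] := freq_gt0_nonempty (lt_le_trans c'0 c'j).
  exists (i, y, F `&` E i, W `&` [set i | `|f (x i) y - g y| < e / 2]) => _.
  split; split => //=; apply: filterI => //; apply: gP.
  by rewrite divr_gt0.
have [y0 _] : [set: Y] !=set0.
  have [c c0 /filter_ex[i /filter_ex[j /= cj]]] := goodT.
  by have [y _] := freq_gt0_nonempty (lt_le_trans c0 cj); exists y.
pose st n := iter n nx (0%N, y0, setT, setT).
have okst n : ok (st n).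
  elim: n => [|n IH]; first by split => //=; exact: filterT.
  by have [] := nxP _ IH.
have stP n : step (st n) (st n.+1) by have [] := nxP _ (okst n).
have Fdecr : forall m n, (m <= n)%N -> (st n).1.2 `<=` (st m).1.2.
  move=> m; elim=> [|n IH]; first by rewrite leqn0 => /eqP ->.
  rewrite leq_eqVlt => /predU1P[->//|/IH H y].
  by have [_ Fs _ _] := stP n => /Fs[/H].
have Wdecr : forall m n, (m <= n)%N -> (st n).2 `<=` (st m).2.
  move=> m; elim=> [|n IH]; first by rewrite leqn0 => /eqP ->.
  rewrite leq_eqVlt => /predU1P[->//|/IH H y].
  by have [_ _ _ Ws] := stP n => /Ws[/H].
pose I n := (st n.+1).1.1.1; pose z n := (st n.+1).1.1.2.
have big k n : (k <= n)%N -> e <= g (z n) - f (x (I k)) (z n).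
  move=> kn; have [_ _ Fz _] := stP n; have [_ Fs _ _] := stP k.
  by have /Fs[] := Fdecr k.+1 n.+1 kn _ Fz.
have small k n : (n < k)%N -> `|f (x (I k)) (z n) - g (z n)| < e / 2.
  move=> nk; have [WI _ _ _] := stP k; have [_ _ _ Ws] := stP n.
  by have /Ws[] := Wdecr n.+1 k nk _ WI.
have gB n : `|g (z n)| <= 1 + e.
  rewrite ler_norml gM andbT.
  have [i /=] := filter_ex (gP (z n) _ e0).
  by rewrite ltr_norml => /andP[_ ?]; have := f1 (x i) (z n); rewrite ler_norml; lra.
(* The bounds so far are relative to [g (z n)], which varies with [n]; a second limit and a
   subsequence make them uniform, leaving a gap of [e / 4]. *)
have [G GP] := ultra_bounded_cvg gB.
have e8 : 0 < e / 8 by rewrite divr_gt0.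
have [h [hmono hW]] := increasing_enumeration Uoo (GP _ e8).
exists (G - e + e / 8), (G - e / 2 - e / 8), (x \o I \o h), (z \o h).
split=> [|i j ji|i j ij]; first lra.
- have := small _ _ (hmono _ _ ji); have := hW j; rewrite /= !ltr_norml; lra.
- have := big _ _ (ltnW (hmono _ _ ij)); have := hW j; rewrite /= !ltr_norml; lra.
Qed.

Lemma robust_order_mean2 (X Y : Type) (f : X -> Y -> R) :
  (forall x y, `|f x y| <= 1) ->
  robust_order (fun k l => mean (fun x => mean (f x) l) k) -> robust_order f.
Proof.
move=> f1 [a [b [p [q [ab hi lo]]]]].
have mean1 (Z : Type) (u : Z -> R) l : (forall z, `|u z| <= 1) -> `|mean u l| <= 1.
  move=> u1; have := @mean_cst_le _ 1 l ler01; rewrite ler_norml => m1.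
  apply/andP; split; last first.
    by apply: le_trans m1; apply: le_mean => z; rewrite (le_trans (ler_norm _)).
  rewrite lerNl -meanN; apply: le_trans m1; apply: le_mean => z.
  by have := u1 z; rewrite ler_norml lerNl => /andP[].
have [a' [b' [p' [y [ab' hi' lo']]]]] : robust_order (fun k y => mean (f^~ y) k).
  apply: robust_order_mean => [k y|]; first by apply: mean1.
  exists a, b, p, q; split => // i j ij; rewrite -exchange_mean; first exact: hi.
  exact: lo.
(* The lists on the other side are removed by the same lemma after exchanging the sides and
   negating. *)
have [a2 [b2 [y2 [x2 [ab2 hi2 lo2]]]]] : robust_order (fun y x => - f x y).
  apply: robust_order_mean => [z w|]; first by rewrite normrN.
  exists (- b'), (- a'), y, p'; split=> [|i j ij|i j ij]; first by rewrite ltrN2.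
    by rewrite meanN lerN2; exact: lo'.
  by rewrite meanN lerN2; exact: hi'.
exists (- b2), (- a2), x2, y2; split=> [|i j ij|i j ij]; first by rewrite ltrN2.
  by rewrite lerNl; exact: lo2.
by rewrite lerNr; exact: hi2.
Qed.

End RobustOrder.

(** * Minimax with one finite side, and robust order from a gap *)

Section Approachability.
Local Open Scope classical_set_scope.
Local Open Scope ring_scope.
Variable R : realType.

(* Blackwell's approachability argument: weighting the coordinates by the
   positive parts of their running sums makes the squared distance to the
   negative orthant grow only linearly in the number of rounds. *)
Lemma approach_negative_orthant (Y : Type) k (F : 'I_k -> Y -> R) (C e : R) :
  0 < e -> (forall i y, `|F i y| <= C) ->
  (forall w : 'I_k -> R, (forall i, 0 <= w i) ->
     exists y, \sum_i w i * F i y <= 0) ->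
  exists2 l, l <> [::] & forall i, mean (F i) l <= e.
Proof.
move=> e0 FC Fw; pose S l i := \sum_(y <- l) F i y.
have posD (u v : R) : Num.max 0 (u + v) ^+ 2 <=
    Num.max 0 u ^+ 2 + 2 * (Num.max 0 u * v) + v ^+ 2.
  rewrite /Num.max; case: (ltP 0 (u + v)); case: (ltP 0 u); nra.
have pot N : exists2 l, size l = N &
    \sum_i Num.max 0 (S l i) ^+ 2 <= C ^+ 2 * k%:R * N%:R.
  elim: N => [|N [l lN Sl]].
    by exists [::] => //; rewrite mulr0 big1// => i _; rewrite /S big_nil maxxx expr0n.
  have [i|y Fy] := Fw (fun i => Num.max 0 (S l i)); first by rewrite le_max lexx.
  exists (y :: l); first by rewrite /= lN.
  apply: (@le_trans _ _ (\sum_i (Num.max 0 (S l i) ^+ 2 +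
      2 * (Num.max 0 (S l i) * F i y) + C ^+ 2))).
    apply: ler_sum => i _; rewrite /S big_cons addrC.
    apply: le_trans (posD _ _) _; rewrite lerD2l -real_normK ?num_real//.
    by rewrite lerXn2r ?nnegrE// (le_trans _ (FC i y)).
  rewrite !big_split /= -mulr_sumr sumr_const card_ord -[C ^+ 2 *+ k]mulr_natr -natr1.
  nra.
(* This many rounds make the bound [C ^+ 2 * k * N] on the squared sums smaller than
   [(e * N) ^+ 2]. *)
pose N := (Num.truncn (C ^+ 2 * k%:R / e ^+ 2)).+1.
have [l lN Sl] := pot N; exists l; first by move=> l0; rewrite l0 in lN.
move=> i; have N0 : 0 < N%:R :> R by rewrite ltr0n.
rewrite /mean lN ler_pdivrMr// leNgt; apply/negP => eS.
have SN : Num.max 0 (S l i) ^+ 2 <= C ^+ 2 * k%:R * N%:R.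
  apply: le_trans Sl; rewrite (bigD1 i)//= lerDl sumr_ge0// => j _.
  exact: sqr_ge0.
have : C ^+ 2 * k%:R / e ^+ 2 < N%:R by exact: truncnS_gt.
rewrite ltr_pdivrMr ?exprn_gt0// => CN.
have : e * N%:R < Num.max 0 (S l i) by rewrite lt_max eS orbT.
have : 0 < e * N%:R by rewrite mulr_gt0.
move: CN SN; set m := Num.max _ _; set c := C ^+ 2 * _; set n := N%:R.
rewrite -/n in N0 *; clearbody m c n; clear -N0 e0; move=> CN SN en em.
have : e * n * (e * n) < m ^+ 2 by rewrite expr2; apply: ltr_pM => //; exact: ltW.
have : c * n < n * e ^+ 2 * n by rewrite ltr_pM2r.
nra.
Qed.

Lemma In_nth (X : Type) (x0 x : X) (A : seq X) :
  List.In x A -> exists2 i, (i < size A)%N & nth x0 A i = x.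
Proof.
elim: A => [|z A IH]//= [->|/IH[i iA ix]]; first by exists 0%N.
by exists i.+1.
Qed.

(** Approachability, applied to the coordinates [f x - a] for [x] in [A], merges the pure replies to
    the various weightings into one list that works against all of [A]; the slack [a' - a] is its
    error. *)
Lemma finite_side_minimax (X Y : Type) (f : X -> Y -> R) (a a' : R) :
  [set: X] !=set0 -> a < a' -> (forall x y, `|f x y| <= 1) ->
  (forall k (x : 'I_k -> X) (w : 'I_k -> R), (forall i, 0 <= w i) ->
    exists y, \sum_i w i * (f (x i) y - a) <= 0) ->
  forall A, exists2 l, l <> [::] & forall x, List.In x A -> mean (f x) l <= a'.
Proof.
move=> [x0 _] aa' f1 H A.
have [||w w0|l l0 lP] := @approach_negative_orthant Y (size A)
  (fun i y => f (nth x0 A i) y - a) (1 + `|a|) (a' - a).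
- by rewrite subr_gt0.
- by move=> i y; rewrite (le_trans (ler_normB _ _))// lerD2r.
- exact: H.
exists l => // x /(In_nth x0)[i iA <-].
have := lP (Ordinal iA); rewrite meanD mean_cst//=; lra.
Qed.

Lemma minimax_gap_robust_order (X Y : Type) (f : X -> Y -> R) (a b : R) :
  [set: X] !=set0 -> [set: Y] !=set0 ->
  a < b -> (forall x y, `|f x y| <= 1) ->
  (forall k (x : 'I_k -> X) (w : 'I_k -> R), (forall i, 0 <= w i) ->
    exists y, \sum_i w i * (f (x i) y - a) <= 0) ->
  (forall k (y : 'I_k -> Y) (w : 'I_k -> R), (forall i, 0 <= w i) ->
    exists x, 0 <= \sum_i w i * (f x (y i) - b)) ->
  robust_order f.
Proof.
move=> X0 Y0 ab f1 Ha Hb; apply: robust_order_mean2 => //.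
pose a' := a + (b - a) / 3; pose b' := b - (b - a) / 3.
have aa' : a < a' by rewrite /a'; lra.
have bb' : - b < - b' by rewrite /b'; lra.
have /choice[Q QP] : forall A, exists l, l <> [::] /\
    forall x, List.In x A -> mean (f x) l <= a'.
  by move=> A; have [l l0 lP] := finite_side_minimax X0 aa' f1 Ha A; exists l.
have Hb' k (y : 'I_k -> Y) (w : 'I_k -> R) : (forall i, 0 <= w i) ->
    exists x, \sum_i w i * (- f x (y i) - - b) <= 0.
  move=> /(Hb _ y)[x xP]; exists x; rewrite -oppr_ge0 -sumrN.
  by apply: le_trans xP _; apply: ler_sum => i _; lra.
have f1' y x : `|- f x y| <= 1 by rewrite normrN.
have /choice[P PP] : forall B, exists k, k <> [::] /\
    forall y, List.In y B -> b' <= mean (f^~ y) k.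
  move=> B; have [k k0 kP] := finite_side_minimax Y0 bb' f1' Hb' B.
  by exists k; split => // y /kP; rewrite meanN lerN2.
(* The state collects all points used so far. In each round [Q] first answers every earlier [x],
   then [P] answers every [y], including those just added. *)
pose nx (s : seq X * seq Y) := (P (Q s.1 ++ s.2) ++ s.1, Q s.1 ++ s.2).
pose st n := iter n nx ([::], [::]).
have Amono m n : (m <= n)%N -> forall x, List.In x (st m).1 -> List.In x (st n).1.
  elim: n => [|n IH]; first by rewrite leqn0 => /eqP ->.
  rewrite leq_eqVlt => /predU1P[->//|/IH H x /H xn].
  by apply: List.in_or_app; right.
have Bmono m n : (m <= n)%N -> forall y, List.In y (st m).2 -> List.In y (st n).2.
  elim: n => [|n IH]; first by rewrite leqn0 => /eqP ->.
  rewrite leq_eqVlt => /predU1P[->//|/IH H y /H yn].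
  by apply: List.in_or_app; right.
exists a', b', (fun n => P (st n.+1).2), (fun n => Q (st n).1).
split=> [|i j ji|i j ij]; first by rewrite /a' /b'; lra.
- rewrite exchange_mean -[leLHS](mean_cst b' (QP (st j).1).1).
  apply: le_mean_In => y yj; apply: (PP _).2.
  by apply: (@Bmono j.+1 i.+1); [exact: ltnW|apply: List.in_or_app; left].
- rewrite -[leRHS](mean_cst a' (PP (st i.+1).2).1).
  apply: le_mean_In => x xi; apply: (QP _).2.
  by apply: (@Amono i.+1 j) => //; apply: List.in_or_app; left.
Qed.

End Approachability.

(** * Payoffs of finitely supported mixed strategies *)

Section Games.
Local Open Scope classical_set_scope.
Local Open Scope ring_scope.
Local Notation R := Rdefinitions.R.

Lemma mixed_payoffE (X Y : Type) (pi : X -> Y -> bool) (p : X -> R) (q : Y -> R) :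
  (forall x, 0 <= p x) -> (forall y, 0 <= q y) ->
  mixed_payoff pi p q = \esum_(x in [set: {classic X}])
    \esum_(y in [set: {classic Y}]) (p x * q y * (pi x y)%:R)%:E.
Proof.
move=> p0 q0; rewrite esum_esum; last first.
  by move=> x y _ _; rewrite lee_fin !mulr_ge0.
rewrite (reindex_esum [set: {classic (X * Y)}] _
  (fun k : {classic (X * Y)} => (k.1, k.2) : {classic X} * {classic Y})%type)//.
split=> //; first by move=> [x1 y1] [x2 y2] _ _ [-> ->].
by move=> [x y] _; exists (x, y).
Qed.

Lemma mixed_payoff_swap (X Y : Type) (pi : X -> Y -> bool) (p : X -> R) (q : Y -> R) :
  mixed_payoff pi p q = mixed_payoff (fun y x => pi x y) q p.
Proof.
rewrite /mixed_payoff (reindex_esum [set: {classic (Y * X)}] _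
  (fun k : {classic (Y * X)} => (k.2, k.1) : {classic (X * Y)}))//=.
  by apply: eq_esum => -[y x] _ /=; rewrite [p x * _]mulrC.
split=> //; first by move=> [x1 y1] [x2 y2] _ _ [-> ->].
by move=> [x y] _; exists (y, x).
Qed.

(** The family [s] may repeat a point, whose weights then add up. *)
Definition mixture (X : Type) k (w : 'I_k -> R) (s : 'I_k -> X) : X -> R :=
  fun x => \sum_i w i * `[< x = s i >]%:R.

Lemma mixture_ge0 (X : Type) k (w : 'I_k -> R) (s : 'I_k -> X) x :
  (forall i, 0 <= w i) -> 0 <= mixture w s x.
Proof. by move=> w0; apply: sumr_ge0 => i _; rewrite mulr_ge0. Qed.

Lemma esum_mixture (X : Type) k (w : 'I_k -> R) (s : 'I_k -> X) (F : X -> R) :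
  (forall i, 0 <= w i) -> (forall x, 0 <= F x) ->
  \esum_(x in [set: {classic X}]) (mixture w s x * F x)%:E =
  (\sum_i w i * F (s i))%:E.
Proof.
move=> w0 F0.
transitivity (\esum_(x in [set: {classic X}])
    (\sum_(i <- index_enum 'I_k) (w i * `[< x = s i >]%:R * F x)%:E)%E).
  by apply: eq_esum => x _; rewrite sumEFin /mixture mulr_suml.
rewrite esum_sum; last by move=> x i _ _; rewrite lee_fin !mulr_ge0.
rewrite -sumEFin; apply: eq_bigr => i _.
rewrite -(@esum_set1 R {classic X} (s i) (fun x => (w i * F x)%:E)); last first.
  by rewrite lee_fin mulr_ge0.
rewrite [RHS]esum_mkcond; apply: eq_esum => x _.
case: ifPn => [/[!inE] xs|]; first by rewrite asboolT// mulr1.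
by rewrite notin_setE => xs; rewrite asboolF// mulr0 mul0r.
Qed.

Lemma mixture_distr (X : Type) k (w : 'I_k -> R) (s : 'I_k -> X) :
  (forall i, 0 <= w i) -> \sum_i w i = 1 -> @distr X (mixture w s).
Proof.
move=> w0 w1; split; first by move=> x; exact: mixture_ge0.
split.
  apply: (@sub_countable _ _ _ (s @` setT)).
    apply: subset_card_le => x /= /eqP mx; apply: contrapT => xs; apply: mx.
    rewrite /mixture big1// => i _; rewrite asboolF ?mulr0// => xi; apply: xs.
    by exists i.
  apply: finite_set_countable; exact: finite_image.
have := @esum_mixture X k w s (fun=> 1) w0 (fun=> ler01).
by under eq_esum do rewrite mulr1; under eq_bigr do rewrite mulr1; rewrite w1.
Qed.

Lemma mixed_payoff_mixture (X Y : Type) (pi : X -> Y -> bool) k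
    (w : 'I_k -> R) (s : 'I_k -> X) (q : Y -> R) :
  (forall i, 0 <= w i) -> (forall y, 0 <= q y) ->
  mixed_payoff pi (mixture w s) q =
  \esum_(y in [set: {classic Y}]) (q y * \sum_i w i * (pi (s i) y)%:R)%:E.
Proof.
move=> w0 q0; rewrite mixed_payoff_swap mixed_payoffE//; last first.
  by move=> x; exact: mixture_ge0.
apply: eq_esum => y _.
transitivity (\esum_(x in [set: {classic X}])
    (mixture w s x * (q y * (pi x y)%:R))%:E).
  by apply: eq_esum => x _; rewrite mulrCA mulrA.
rewrite esum_mixture// => [|x]; last by rewrite mulr_ge0.
by rewrite mulr_sumr; congr EFin; apply: eq_bigr => i _; rewrite mulrCA.
Qed.

Lemma ge0_esumZl (X : choiceType) (S : set X) (c : R) (F : X -> R) :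
  0 <= c -> (forall x, 0 <= F x) ->
  \esum_(x in S) (c * F x)%:E = (c%:E * \esum_(x in S) (F x)%:E)%E.
Proof.
move=> c0 F0; rewrite /esum -ereal_supZl//; last first.
  by apply/set0P; eexists; exists set0 => //; exact: fsets_set0.
congr ereal_sup; rewrite image_comp; apply: eq_imagel => A [finA _] /=.
by rewrite ge0_mule_fsumr// => x; rewrite lee_fin.
Qed.

Lemma mixed_payoff_mixture_ge (X Y : Type) (pi : X -> Y -> bool) k
    (w : 'I_k -> R) (s : 'I_k -> X) (q : Y -> R) (a : R) :
  (forall i, 0 <= w i) -> @distr Y q ->
  (forall y, a <= \sum_i w i * (pi (s i) y)%:R) ->
  (a%:E <= mixed_payoff pi (mixture w s) q)%E.
Proof.
move=> w0 [q0 [_ q1]] aF; rewrite mixed_payoff_mixture//.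
(* [ge0_esumZl] scales by nonnegative factors; a negative [a] lies below every payoff. *)
have [a0|a0] := leP 0 a; last first.
  apply: (@le_trans _ _ 0%E); first by rewrite lee_fin ltW.
  apply: esum_ge0 => y _; rewrite lee_fin mulr_ge0// sumr_ge0// => i _.
  by rewrite mulr_ge0.
rewrite -[leLHS]mule1 -q1 -ge0_esumZl//; apply: le_esum => y _.
by rewrite lee_fin mulrC ler_wpM2l.
Qed.

Lemma mixed_payoff_mixture_le (X Y : Type) (pi : X -> Y -> bool) k
    (w : 'I_k -> R) (s : 'I_k -> X) (q : Y -> R) (b : R) :
  (forall i, 0 <= w i) -> @distr Y q -> 0 <= b ->
  (forall y, \sum_i w i * (pi (s i) y)%:R <= b) ->
  (mixed_payoff pi (mixture w s) q <= b%:E)%E.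
Proof.
move=> w0 [q0 [_ q1]] b0 Fb; rewrite mixed_payoff_mixture//.
rewrite -[leRHS]mule1 -q1 -ge0_esumZl//; apply: le_esum => y _.
by rewrite lee_fin [b * _]mulrC ler_wpM2l.
Qed.

(** * From a gap between the two values to a half graph *)

Lemma ereal_real_gap (x y : \bar R) : (x < y)%E ->
  exists a b : R, [/\ a < b, (x < a%:E)%E & (b%:E < y)%E].
Proof.
case: x y => [x| |] [y| |] //= => [|_|_|_].
- rewrite lte_fin => xy; exists (x + (y - x) / 3), (y - (y - x) / 3).
  by rewrite !lte_fin; split; lra.
- by exists (x + 1), (x + 2); rewrite lte_fin ltry; split => //; lra.
- by exists (y - 2), (y - 1); rewrite lte_fin ltNyr; split => //; lra.
- by exists 0, 1; rewrite ltNyr ltry.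
Qed.

Lemma minimax_weak_duality (X Y : Type) (pi : X -> Y -> bool) :
  (ereal_sup [set ereal_inf [set mixed_payoff pi p q | q in @distr Y]
             | p in @distr X] <=
   ereal_inf [set ereal_sup [set mixed_payoff pi p q | p in @distr X]
             | q in @distr Y])%E.
Proof.
apply: ge_ereal_sup => _ [p pX <-]; apply: le_ereal_inf_tmp => _ [q qY <-].
apply: (@le_trans _ _ (mixed_payoff pi p q)).
  by apply: ereal_inf_lbound; exists q.
by apply: ereal_sup_ubound; exists p.
Qed.

Lemma normalized_weights k (w : 'I_k -> R) : (forall i, 0 <= w i) ->
  (forall i, w i = 0) \/
  [/\ 0 < \sum_i w i, (forall i, 0 <= w i / \sum_i w i) &
      \sum_i (w i / \sum_i w i) = 1].
Proof.
move=> w0; have W0 : 0 <= \sum_i w i by apply: sumr_ge0.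
have [W|/eqP W] := eqVneq (\sum_i w i) 0.
  by left=> i; apply: (psumr_eq0P _ W).
right; split; first by rewrite lt0r W0 andbT; apply/eqP.
- by move=> i; rewrite divr_ge0.
- by rewrite -mulr_suml divff//; apply/eqP.
Qed.

Lemma weighted_excess k (w u : 'I_k -> R) (c : R) : 0 < \sum_i w i ->
  \sum_i w i * (u i - c) =
  (\sum_i w i) * (\sum_i (w i / \sum_i w i) * u i - c).
Proof.
move=> W0; rewrite mulrBr mulr_sumr mulr_suml -sumrB; apply: eq_bigr => i _.
by rewrite mulrA [_ * (w i / _)]mulrC divfK ?gt_eqF// mulrBr.
Qed.

(** By weak duality, reals [a < b] fit strictly between the two values. Nonzero weights without the
    required pure reply would normalize to a strategy guaranteeing at least [a], or conceding at
    most [b], against the values. *)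
Lemma not_minimax_robust_order (X Y : Type) (pi : X -> Y -> bool) :
  [set: X] !=set0 -> [set: Y] !=set0 -> ~ minimax_property pi ->
  robust_order (fun x y => (pi x y)%:R : R).
Proof.
move=> X0 Y0 /eqP npi.
have := minimax_weak_duality pi; rewrite le_eqVlt (negPf npi)/= => {npi}.
move=> /ereal_real_gap[a [b [ab supa infb]]].
apply: (minimax_gap_robust_order X0 Y0 ab).
- by move=> x y; case: (pi _ _); rewrite ?normr1 ?normr0.
- move=> k s w w0; apply: contrapT => noy.
  have pos y : 0 < \sum_i w i * ((pi (s i) y)%:R - a).
    by rewrite ltNge; apply/negP => ?; apply: noy; exists y.
  have [wz|[W0 v0 v1]] := normalized_weights w0.
    have [y _] := Y0; have := pos y.
    by rewrite big1 ?ltxx// => i _; rewrite wz mul0r.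
  have pd := mixture_distr s v0 v1.
  have : (ereal_inf [set mixed_payoff pi (mixture (fun i => w i / \sum_i w i)%R s) q
      | q in @distr Y] < a%:E)%E.
    by apply: le_lt_trans supa; apply: ereal_sup_ubound; eexists; first exact: pd.
  move=> /ereal_inf_lt[_ [q qd <-]]; apply/negP; rewrite -leNgt.
  apply: mixed_payoff_mixture_ge => // y.
  by have := pos y; rewrite weighted_excess// pmulr_rgt0// subr_gt0 => /ltW.
- move=> k t w w0; apply: contrapT => nox.
  have neg x : \sum_i w i * ((pi x (t i))%:R - b) < 0.
    by rewrite ltNge; apply/negP => ?; apply: nox; exists x.
  have [x0 _] := X0.
  have [wz|[W0 v0 v1]] := normalized_weights w0.
    by have := neg x0; rewrite big1 ?ltxx// => i _; rewrite wz mul0r.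
  have lt_b x : \sum_i (w i / \sum_i w i) * (pi x (t i))%:R < b.
    by have := neg x; rewrite weighted_excess// pmulr_rlt0// subr_lt0.
  have qd := mixture_distr t v0 v1.
  have : (b%:E < ereal_sup [set mixed_payoff pi p
      (mixture (fun i => w i / \sum_i w i)%R t) | p in @distr X])%E.
    apply: lt_le_trans infb _; apply: ereal_inf_lbound.
    by eexists; first exact: qd.
  move=> /ereal_sup_gt[_ [p pd <-]]; apply/negP; rewrite -leNgt.
  rewrite mixed_payoff_swap; apply: mixed_payoff_mixture_le => // [|x].
    apply: le_trans (ltW (lt_b x0)); apply: sumr_ge0 => i _.
    by rewrite mulr_ge0.
  exact: ltW.
Qed.

Lemma robust_order_half_graph (X Y : Type) (pi : X -> Y -> bool) :
  robust_order (fun x y => (pi x y)%:R : R) ->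
  exists (x : nat -> X) (y : nat -> Y),
    forall i j, (1 <= i)%N -> (1 <= j)%N -> pi (x i) (y j) = (j <= i)%N.
Proof.
move=> [a [b [x [y [ab hi lo]]]]].
have a0 : 0 <= a by apply: le_trans (lo 0%N 1%N _).
have b1 : b <= 1.
  by apply: le_trans (hi 1%N 0%N _) _ => //; rewrite lern1 leq_b1.
(* Even indices for [x] and odd ones for [y] avoid the unconstrained diagonal: [2j - 1 < 2i] exactly
   when [j <= i]. *)
exists (fun i => x i.*2), (fun j => y j.*2.-1) => i j i1 j1.
have [ji|ij] := leqP j i.
- have /hi : (j.*2.-1 < i.*2)%N.
    by rewrite prednK ?double_gt0// leq_double.
  by case: (pi _ _) => //=; lra.
- have /lo : (i.*2 < j.*2.-1)%N.
    by case: j j1 ij => // j _ ij; rewrite doubleS /= ltnS leq_double.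
  by case: (pi _ _) => //=; lra.
Qed.

(** * Half graphs are not minimax *)

Lemma distr_concentrated (X : Type) (p : X -> R) (r : X -> nat) : @distr X p ->
  exists n, ((2 / 3)%:E <
    \esum_(x in [set: {classic X}]) (p x * (r x <= n)%N%:R)%:E)%E.
Proof.
move=> [p0 [_ p1]].
have : ((2 / 3)%:E < \esum_(x in [set: {classic X}]) (p x)%:E)%E.
  by rewrite p1 lte_fin; lra.
move=> /ereal_sup_gt[_ [A [finA _] <-] pA].
(* The finite set [A] carries more than [2 / 3] of the mass, and [r] is bounded on it. *)
exists (\max_(x <- fset_set A) r x)%N; apply: lt_le_trans pA _.
apply: esum_ge; exists A => //; rewrite le_eqVlt; apply/orP; left; apply/eqP.
apply: eq_fsbigr => x xA; rewrite leq_bigmax_seq ?mulr1//.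
by rewrite in_fset_set.
Qed.

(** The lower value is at most [1 / 3] and the upper one at least [2 / 3]. Unbounded ranks replace
    sequences, so that the points may come from subtypes. *)
Lemma half_graph_not_minimax (X Y : Type) (pi : X -> Y -> bool)
    (rx : X -> nat) (ry : Y -> nat) :
  (forall x y, pi x y = (ry y <= rx x)%N) ->
  (forall n, exists x, (n <= rx x)%N) -> (forall n, exists y, (n < ry y)%N) ->
  ~ minimax_property pi.
Proof.
move=> piE xoo yoo.
have one0 : forall i : 'I_1, 0 <= (fun=> 1) i :> R by move=> _; exact: ler01.
have one1 : \sum_(i < 1) 1 = 1 :> R by rewrite big_ord1.
pose dirac Z z := @mixture Z 1 (fun=> 1) (fun=> z).
have diracP Z z : @distr Z (dirac Z z) by exact: mixture_distr.
move=> /eqP; rewrite eq_le => /andP[_ ge].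
have upper : (ereal_sup [set ereal_inf [set mixed_payoff pi p q | q in @distr Y]
             | p in @distr X] <= (1 / 3)%:E)%E.
  apply: ge_ereal_sup => _ [p pd <-].
  have [n pn] := distr_concentrated rx pd; have [y ny] := yoo n.
  have [p0 [_ p1]] := pd.
  apply: (@le_trans _ _ (mixed_payoff pi p (dirac Y y))).
    by apply: ereal_inf_lbound; exists (dirac Y y).
  rewrite mixed_payoff_swap mixed_payoff_mixture//.
  set s := esum _ _; set t := esum _ _ in pn.
  (* The payoff [s] against [y] counts mass of rank at least [ry y > n], and [t] mass of rank at
     most [n]. *)
  have st : (s + t <= 1)%E.
    rewrite -p1 -esumD; last 2 first.
    - by move=> x _; rewrite big_ord1 mul1r lee_fin mulr_ge0.
    - by move=> x _; rewrite lee_fin mulr_ge0.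
    apply: le_esum => x _; rewrite big_ord1 mul1r lee_fin -mulrDr.
    rewrite ler_piMr// piE -natrD lern1.
    case: (leqP (rx x) n) => nx; last by rewrite addn0 leq_b1.
    by rewrite [(ry y <= _)%N]leqNgt (leq_ltn_trans nx).
  have := le_trans (leeD2l s (ltW pn)) st; rewrite -leeBrDr// => /le_trans; apply.
  by rewrite -EFinB lee_fin; clear; lra.
suff lower : ((2 / 3)%:E <= ereal_inf [set ereal_sup
    [set mixed_payoff pi p q | p in @distr X] | q in @distr Y])%E.
  by have := le_trans lower (le_trans ge upper); rewrite lee_fin; clear; lra.
apply: le_ereal_inf_tmp => _ [q qd <-].
have [n qn] := distr_concentrated ry qd; have [x nx] := xoo n.
have [q0 _] := qd.
apply: (@le_trans _ _ (mixed_payoff pi (dirac X x) q)); last first.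
  by apply: ereal_sup_ubound; exists (dirac X x).
rewrite mixed_payoff_mixture//; apply: le_trans (ltW qn) _.
apply: le_esum => y _; rewrite big_ord1 mul1r lee_fin ler_wpM2l// ler_nat piE.
by case: (leqP (ry y) n) => //= yn; rewrite (leq_trans yn).
Qed.

End Games.

(** * Stability and totally minimax games *)

Theorem theorem4p9 (L : language) (T : theory L) :
  complete_theory T ->
  (stable T <->
   forall (n m : nat) (phi : formula L), fv_below (n + m) phi ->
   forall M : structure L, is_model M T ->
     totally_minimax (formula_game n m phi M)).
Proof.
move=> _; split=> [stT n m phi fv M MT S0 T0 [s0 S0s] [t0 T0t]|tm n m phi fv].
  apply: contrapT => nmm; apply: (stT n m phi fv).
  have [||x [y xy]] := robust_order_half_graph (not_minimax_robust_order _ _ nmm).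
  - by exists (exist _ s0 S0s).
  - by exists (exist _ t0 T0t).
  exists M, (fun i => proj1_sig (x i)), (fun j => proj1_sig (y j)).
  split=> // i j i1 j1; rewrite -xy//.
  by split=> [/asboolP//|/asboolP].
move=> [M [a [b [MT ab]]]].
(* The subgame spanned by the two sequences is a half graph; a strategy is ranked by a chosen index
   at which it occurs. *)
pose S0 := [set s | exists i, (1 <= i)%N /\ a i = s]%classic.
pose T0 := [set t | exists j, (1 <= j)%N /\ b j = t]%classic.
have aS i : (1 <= i)%N -> S0 (a i) by exists i.
have bT j : (1 <= j)%N -> T0 (b j) by exists j.
have := tm n m phi fv M MT S0 T0
  (ex_intro _ _ (aS 1%N isT)) (ex_intro _ _ (bT 1%N isT)).
have /choice[rx rxP] : forall s : {x | S0 x}, exists i,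
    (1 <= i)%N /\ a i = proj1_sig s by case.
have /choice[ry ryP] : forall t : {y | T0 y}, exists j,
    (1 <= j)%N /\ b j = proj1_sig t by case.
apply: (@half_graph_not_minimax _ _ _ rx ry) => [s t|k|k].
- have [i1 <-] := rxP s; have [j1 <-] := ryP t.
  by apply/asboolP/idP => /ab-/(_ i1 j1).
- exists (exist _ (a k.+1) (aS k.+1 isT)).
  set s := exist _ _ _; have [i1 /= si] := rxP s.
  (* [rx s] need not be [k.+1], but [a (rx s)] equals [a k.+1], which is related to [b k.+1], so
     [k.+1 <= rx s]. *)
  by apply: ltnW; apply/(ab _ k.+1 i1 isT); rewrite si; apply/ab.
- exists (exist _ (b k.+1) (bT k.+1 isT)).
  set t := exist _ _ _; have [j1 /= tj] := ryP t.
  by apply/(ab _ k.+1 j1 isT); rewrite -tj; apply/ab.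
Qed.
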